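(* Let $\mathbb X^0_z(\mathbb C)$ be the set of formal power series $\sum_{n=1}^\infty a_nz^n$ over $\mathbb C$ with $a_1\neq0$, with the composition $\circ$ and the topology $\tau$ of coefficientwise convergence. Let $\phi:\mathbb X^0_z(\mathbb C)\to\mathbb C^{\mathbb N}$, $\phi\left(\sum_{n=1}^\infty a_nz^n\right)=(a_1,a_2,\dots)$, and let $A$ be the maximal atlas compatible with $\{(\mathbb X^0_z(\mathbb C),\phi)\}$. Then $((\mathbb X^0_z(\mathbb C),\circ,\tau),A)$ is a Fréchet-Lie group modeled on $\mathbb C^{\mathbb N}$.
   Context: $\mathbb C^{\mathbb N}$ is the Fréchet space of all complex sequences with the seminorms given by the absolute values of the individual coordinates (product topology). The composition of two series $g=\sum_{k\ge1}b_kz^k$, $f=\sum_{n\ge1}a_nz^n$ with zero constant term is the usual formal substitution $g\circ f=\sum_{k\ge1}b_kf^k$ (each coefficient is a finite sum). A Fréchet-Lie group modeled on a Fréchet space $E$ is a group that is also a smooth manifold modeled on $E$ such that multiplication and inversion are smooth; a map between open subsets of Fréchet spaces is smooth ($C^\infty$) if it is continuous and all its iterated directional derivatives exist and are jointly continuous in the base point and the directions. *)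

(* Defs.v *)
From HB Require Import structures.
From mathcomp Require Import all_boot all_order all_algebra.
From mathcomp Require Import all_classical all_reals all_analysis.
From mathcomp Require Import complex.

Set Implicit Arguments.
Unset Strict Implicit.
Unset Printing Implicit Defensive.

Import Order.TTheory GRing.Theory Num.Theory.
Import numFieldTopology.Exports numFieldNormedType.Exports.

Local Open Scope classical_set_scope.
Local Open Scope ring_scope.

HB.instance Definition _ (G H : ptopologicalType) := Pointed.on (G * H)%type.
HB.instance Definition _ (K : numFieldType) (E F : preTopologicalLmodType K) :=
  GRing.Lmodule.on (E * F)%type.

(** * Smooth maps between Frechet spaces *)

Section Smooth.
Context {K : numFieldType}.

(* As everywhere in the library, norms take their values in K itself: for
   K = R[i], [x < y] says that [y - x] is a positive real number. *)
Definition is_seminorm (E : lmodType K) (p : E -> K) : Prop :=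
  [/\ forall x, 0 <= p x,
      forall x y, p (x + y) <= p x + p y &
      forall a x, p (a *: x) = `|a| * p x].

Definition frechet_space (E : preTopologicalLmodType K) : Prop :=
  exists p : nat -> E -> K,
  [/\ forall i, is_seminorm (p i),
      (* the topology of E is the one generated by the seminorms *)
      forall (x : E) (U : set E), nbhs x U <->
        exists n : nat, exists2 e : K, 0 < e &
          forall y, (forall i, (i <= n)%N -> p i (y - x) < e) -> U y,
      (* E is Hausdorff *)
      forall x, (forall i, p i x = 0) -> x = 0 &
      (* E is complete *)
      forall u : nat -> E,
        (forall i (e : K), 0 < e -> exists N : nat, forall m n,
           (N <= m)%N -> (N <= n)%N -> p i (u m - u n) < e) ->
        exists l : E, u n @[n --> \oo] --> l].

(* [S : set K] is the set of scalars t along which difference quotients are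
   formed. A complex Frechet space carries two notions of directional
   derivative: S = setT (t -> 0 in C) and S = the reals (t -> 0 in R). *)
Definition is_dirder (S : set K) (E F : preTopologicalLmodType K)
    (f : E -> F) (x h : E) (d : F) : Prop :=
  t^-1 *: (f (x + t *: h) - f x) @[t --> within S (0 : K)^'] --> d.

(* [D [:: h_k; ...; h_1] x] is the k-th iterated directional derivative of f
   at x, first in the direction h_1, and so on. It is jointly continuous as a
   map U x E^k -> F. Since U is open, the values of the total function f
   outside of U are irrelevant. *)
Definition smooth_on (S : set K) (E F : preTopologicalLmodType K)
    (U : set E) (f : E -> F) : Prop :=
  open U /\ exists D : seq E -> E -> F,
  [/\ forall x, U x -> D [::] x = f x,
      forall (hs : seq E) (h x : E), U x ->
        is_dirder S (D hs) x h (D (h :: hs) x) &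
      forall k : nat,
        {within U `*` [set: {ptws 'I_k -> E}],
         continuous (fun p : E * {ptws 'I_k -> E} => D (codom p.2) p.1)}].

End Smooth.

(** * Smooth manifolds and Lie groups modeled on a Frechet space *)

Record chart (G E : Type) := Chart { cdom : set G ; cmap :> G -> E }.

Section Manifold.
Context {K : numFieldType} (S : set K).

Definition cinv (G : ptopologicalType) (E : Type) (c : chart G E) : E -> G :=
  'pinv_(fun=> point) (cdom c) c.

(* c is a homeomorphism from an open subset of G onto an open subset of E. *)
Definition is_chart (G : ptopologicalType) (E : preTopologicalLmodType K)
    (c : chart G E) : Prop :=
  [/\ open (cdom c), open (c @` cdom c), {in cdom c &, injective c},
      {within cdom c, continuous c} &
      {within c @` cdom c, continuous (cinv c)}].

Definition compatible (G : ptopologicalType) (E : preTopologicalLmodType K)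
    (c d : chart G E) : Prop :=
  smooth_on S (c @` (cdom c `&` cdom d)) (d \o cinv c) /\
  smooth_on S (d @` (cdom c `&` cdom d)) (c \o cinv d).

Definition is_atlas (G : ptopologicalType) (E : preTopologicalLmodType K)
    (A : set (chart G E)) : Prop :=
  [/\ forall c, A c -> is_chart c,
      forall x, exists2 c, A c & cdom c x &
      forall c d, A c -> A d -> compatible c d].

Definition is_maximal_atlas (G : ptopologicalType)
    (E : preTopologicalLmodType K) (A : set (chart G E)) : Prop :=
  is_atlas A /\ forall B, is_atlas B -> A `<=` B -> B = A.

(* The maximal atlas compatible with A. *)
Definition maximal_atlas (G : ptopologicalType)
    (E : preTopologicalLmodType K) (A : set (chart G E)) : set (chart G E) :=
  [set c | is_chart c /\ forall d, A d -> compatible c d].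

Definition smooth_manifold (G : ptopologicalType)
    (E : preTopologicalLmodType K) (A : set (chart G E)) : Prop :=
  hausdorff_space G /\ is_maximal_atlas A.

Definition smooth_map (G H : ptopologicalType) (E F : preTopologicalLmodType K)
    (A : set (chart G E)) (B : set (chart H F)) (f : G -> H) : Prop :=
  continuous f /\
  forall x, exists c d, [/\ A c, B d, cdom c x, cdom d (f x) &
    smooth_on S (c @` (cdom c `&` f @^-1` cdom d)) (d \o f \o cinv c)].

Definition prod_chart (G H E F : Type) (c : chart G E) (d : chart H F) :
    chart (G * H) (E * F) :=
  Chart (cdom c `*` cdom d) (fun x => (c x.1, d x.2)).

(* An atlas (not a maximal one) of the product manifold. *)
Definition prod_atlas (G H E F : Type) (A : set (chart G E))
    (B : set (chart H F)) : set (chart (G * H) (E * F)) :=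
  [set e | exists c, exists2 d, A c /\ B d & e = prod_chart c d].

Definition is_group (G : Type) (mul : G -> G -> G) (e : G) (inv : G -> G) :=
  [/\ associative mul, left_id e mul, right_id e mul,
      left_inverse e inv mul & right_inverse e inv mul].

Definition frechet_lie_group (G : ptopologicalType)
    (E : preTopologicalLmodType K) (mul : G -> G -> G) (A : set (chart G E)) :
    Prop :=
  [/\ frechet_space E, smooth_manifold A &
      exists e inv, [/\ is_group mul e inv,
        smooth_map (prod_atlas A A) A (fun x : G * G => mul x.1 x.2) &
        smooth_map A A inv]].

End Manifold.

(** * The space of sequences and the formal power series *)

Definition seqspace (K : numFieldType) : Type := nat -> K^o.

HB.instance Definition _ (K : numFieldType) :=
  GRing.Lmodule.copy (seqspace K) (nat -> K^o).
HB.instance Definition _ (K : numFieldType) :=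
  Topological.copy (seqspace K) {ptws nat -> K^o}.

(* A power series \sum_n a_n z^n is the sequence (a_0, a_1, ...). *)
Section PowerSeries.
Context {K : numFieldType}.
Implicit Types f g : nat -> K.

Definition ps_one : nat -> K := fun n => (n == 0%N)%:R.
Definition ps_X : nat -> K := fun n => (n == 1%N)%:R.

Definition ps_mul f g : nat -> K :=
  fun n => \sum_(i < n.+1) f i * g (n - i)%N.

Definition ps_exp f (k : nat) : nat -> K := iter k (ps_mul f) ps_one.

(* g o f = \sum_(k >= 1) g_k f^k; the terms with k > n do not contribute to the
   coefficient of z^n, see [ps_exp_eq0]. *)
Definition ps_comp g f : nat -> K :=
  fun n => \sum_(1 <= k < n.+1) g k * ps_exp f k n.

Lemma ps_exp_eq0 f k n : f 0%N = 0 -> (n < k)%N -> ps_exp f k n = 0.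
Proof.
move=> f0; elim: k n => // k IHk n nk.
rewrite /ps_exp iterS -/(ps_exp f k) /ps_mul big1 // => -[[|i] /= iltn] _.
  by rewrite f0 mul0r.
by rewrite IHk ?mulr0 // ltn_subLR // addSn ltnS (leq_trans (ltnSE nk)) ?leq_addl.
Qed.

Definition X0 : set {ptws nat -> K^o} := [set a | a 0%N = 0 /\ a 1%N <> 0].

Lemma ps_X_X0 : X0 ps_X.
Proof. by split=> //; apply/eqP; rewrite oner_neq0. Qed.

Lemma ps_comp_X0 g f : X0 g -> X0 f -> X0 (ps_comp g f).
Proof.
move=> [_ g1] [f0 f1]; split; first by rewrite /ps_comp big_geq.
rewrite /ps_comp big_nat1 /ps_exp /= /ps_mul !big_ord_recl big_ord0 /= f0.
rewrite /ps_one /= !(mul0r, add0r, addr0, mulr1).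
by apply/eqP; rewrite mulf_neq0 //; apply/eqP.
Qed.

End PowerSeries.

(* The topology of coefficientwise convergence is the topology on [set_type X0]
   induced by the product topology. *)
Definition fps0 (K : numFieldType) : Type := set_type (@X0 K).

HB.instance Definition _ (K : numFieldType) :=
  Topological.copy (fps0 K) (set_type (@X0 K)).
HB.instance Definition _ (K : numFieldType) :=
  isPointed.Build (fps0 K) (SigSub (mem_set (@ps_X_X0 K)) : set_type (@X0 K)).

Section Fps0.
Context {K : numFieldType}.

Definition coef (a : fps0 K) : nat -> K := \val (a : set_type (@X0 K)).

Definition fps0_comp (g f : fps0 K) : fps0 K :=
  SigSub (mem_set (ps_comp_X0 (set_valP g) (set_valP f))).

Definition fps0_chart : chart (fps0 K) (seqspace K) :=
  Chart setT (fun a n => coef a n.+1).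

End Fps0.

(* Main.v *)
Require Import Defs.
From HB Require Import structures.
From mathcomp Require Import all_boot all_order all_algebra.
From mathcomp Require Import all_classical all_reals all_analysis.
From mathcomp Require Import complex.
From mathcomp Require Import ring zify.

Set Implicit Arguments.
Unset Strict Implicit.
Unset Printing Implicit Defensive.

Import Order.TTheory GRing.Theory Num.Theory.
Import numFieldTopology.Exports numFieldNormedType.Exports.

Local Open Scope classical_set_scope.
Local Open Scope ring_scope.

(** Everything happens in one global chart, [a |-> (a_1, a_2, ..)], whose image
    is the open set of sequences with a nonzero first entry. Three facts then
    give the theorem.

    The group. Modulo [z ^ N] substitution of series is composition of
    polynomials ([agree_comp]), so it is associative with unit [z]. The equation
    [b \o a = z] determines [b] coefficient by coefficient, so every element has
    a left inverse ([ps_linvK]), and a monoid with left inverses is a group.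

    The operations are smooth. The coefficients of [g \o f] and of the inverse
    of [f] are polynomials in finitely many coordinates and, for the inverse,
    in [1 / a_1]. Such rational functions are described by formal expressions
    that may also mention the coordinates of the directions; the expressions are
    closed under formal differentiation and define jointly continuous functions
    ([rational_smooth_data]). A map into a space of sequences is smooth as soon
    as its coordinates are.

    The maximal atlas is an atlas. Two charts that are compatible with the
    global one must be compatible with each other, which is the chain rule for
    the notion of smoothness by iterated directional derivatives
    ([chain_smooth_data]). Its analytic core is strict differentiability
    ([strict_derivative]): the difference quotient
    [(D hs (y + t k) - D hs y) / t] converges to [D (k :: hs) y] even when [y],
    [k] and [hs] move with [t]. As the maps take values in a product of copies
    of the field it suffices to look at one coordinate, where this follows from
    the mean value inequality along the real segment from [y] to [y + t k] and
    the joint continuity of the derivatives. Strict differentiability also makes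
    the iterated derivatives linear in each direction, and then the derivatives
    of a composition are given by the formula of Faa di Bruno, a sum over the
    partitions of the list of directions.

    The real and the complex statement have the same proof: a set of scalars is
    only required to contain the reals and to be closed under products and
    inverses ([scalar_set]). *)

(** * The group of invertible series under substitution *)

Section Algebra.
Context {K : numFieldType}.
Implicit Types (f g h a b : nat -> K) (p q : {poly K}) (n N k : nat).

(** Substitution of series is compared with composition of polynomials, whose
    algebra is known; below degree [N] a series [f] may be replaced by any
    polynomial that agrees with it there. *)
Definition agree N p f := forall n, (n < N)%N -> p`_n = f n.

Lemma agree_poly N f : agree N (\poly_(i < N) f i) f.
Proof. by move=> n nN; rewrite coef_poly nN. Qed.

Lemma agree_exp N q f k : agree N q f -> agree N (q ^+ k) (ps_exp f k).
Proof.
move=> qf; elim: k => [|k IHk] n nN; first by rewrite expr0 coef1.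
rewrite exprS coefM /ps_exp iterS -/(ps_exp f k) /ps_mul.
by apply: eq_bigr => -[i /= iln] _; rewrite qf ?IHk //; lia.
Qed.

(** The two sums differ in range only: the one over [size p] stops early or goes
    beyond [n], but [q ^ i] has no term below degree [i]. *)
Lemma agree_comp N p q g f : g 0%N = 0 -> f 0%N = 0 ->
  agree N p g -> agree N q f -> agree N (p \Po q) (ps_comp g f).
Proof.
move=> g0 f0 pg qf n nN; rewrite coef_comp_poly /ps_comp.
pose F i := p`_i * (q ^+ i)`_n.
have F0 : F 0%N = 0 by rewrite /F pg ?g0 ?mul0r //; lia.
have Fbig i : (n < i)%N -> F i = 0.
  by move=> ni; rewrite /F (agree_exp i qf) // ps_exp_eq0 ?mulr0.
have Fsz i : (size p <= i)%N -> F i = 0.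
  by move=> pi; rewrite /F nth_default ?mul0r.
transitivity (\sum_(0 <= i < maxn (size p) n.+1) F i).
  rewrite (big_cat_nat (n := size p)) ?leq_maxl //= big_mkord -[LHS]addr0.
  congr (_ + _); rewrite big_nat_cond big1 // => i /andP[/andP[pi _] _].
  exact: Fsz.
rewrite (big_cat_nat (n := n.+1)) ?leq_maxr //= [X in _ + X]big_nat_cond.
rewrite [X in _ + X]big1 => [|i /andP[/andP[pi _] _]]; last exact: Fbig.
rewrite addr0 big_ltn // F0 add0r; apply: eq_big_nat => i /andP[_ i_n].
by rewrite /F pg ?(agree_exp i qf) //; lia.
Qed.

Lemma ps_comp0 g f : ps_comp g f 0%N = 0.
Proof. by rewrite /ps_comp big_geq. Qed.

Lemma ps_compA h g f : h 0%N = 0 -> g 0%N = 0 -> f 0%N = 0 ->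
  ps_comp h (ps_comp g f) = ps_comp (ps_comp h g) f.
Proof.
move=> h0 g0 f0; apply/funext => n.
have [[ph pg] pf] := (@agree_poly n.+1 h, @agree_poly n.+1 g, @agree_poly n.+1 f).
rewrite -(agree_comp h0 (ps_comp0 g f) ph (agree_comp g0 f0 pg pf)) //.
by rewrite comp_polyA -(agree_comp (ps_comp0 h g) f0 (agree_comp h0 g0 ph pg) pf).
Qed.

Lemma agree_X N : agree N 'X (@ps_X K).
Proof. by move=> n _; rewrite coefX. Qed.

Lemma ps_comp_Xl f : f 0%N = 0 -> ps_comp ps_X f = f.
Proof.
move=> f0; apply/funext => n.
have pf := @agree_poly n.+1 f.
by rewrite -(agree_comp _ f0 (@agree_X n.+1) pf) // comp_polyX pf.
Qed.

Lemma ps_comp_Xr f : f 0%N = 0 -> ps_comp f ps_X = f.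
Proof.
move=> f0; apply/funext => n.
have pf := @agree_poly n.+1 f.
by rewrite -(agree_comp f0 _ pf (@agree_X n.+1)) // comp_polyXr pf.
Qed.

Lemma ps_exp_diag f n : f 0%N = 0 -> ps_exp f n n = f 1%N ^+ n.
Proof.
move=> f0; elim: n => [|n IHn]; first by rewrite expr0.
rewrite /ps_exp iterS -/(ps_exp f n) /ps_mul !big_ord_recl /= f0 mul0r add0r.
rewrite big1 => [|i _]; first by rewrite addr0 /bump /= subSS subn0 IHn exprS.
by rewrite (ps_exp_eq0 f0) ?mulr0 // /bump /=; case: i => i /=; lia.
Qed.

(** The equation [b \o a = X] at the coefficient of [z ^ n] reads
    [\sum_(k < n) b_k (a ^ k)_n + b_n a_1 ^ n = X_n]: it determines [b_n] from
    the earlier coefficients. The list [ps_linv_seq a n] holds [b_0 .. b_(n-1)]. *)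
Definition ps_linv_step a (s : seq K) : K :=
  (ps_X (size s) - \sum_(1 <= k < size s) s`_k * ps_exp a k (size s))
  * (a 1%N)^-1 ^+ size s.

Fixpoint ps_linv_seq a n : seq K :=
  if n is n'.+1 then
    rcons (ps_linv_seq a n') (ps_linv_step a (ps_linv_seq a n'))
  else [::].

Definition ps_linv a n : K := (ps_linv_seq a n.+1)`_n.

Lemma size_ps_linv_seq a n : size (ps_linv_seq a n) = n.
Proof. by elim: n => //= n IHn; rewrite size_rcons IHn. Qed.

Lemma nth_ps_linv_seq a n k : (k < n)%N -> (ps_linv_seq a n)`_k = ps_linv a k.
Proof.
elim: n => // n IHn; rewrite ltnS leq_eqVlt => /predU1P[->//|kn].
by rewrite /= nth_rcons size_ps_linv_seq kn IHn.
Qed.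

Lemma ps_linvE a n : ps_linv a n =
  (ps_X n - \sum_(1 <= k < n) ps_linv a k * ps_exp a k n) * (a 1%N)^-1 ^+ n.
Proof.
rewrite /ps_linv /= nth_rcons size_ps_linv_seq ltnn eqxx /ps_linv_step.
rewrite size_ps_linv_seq; congr ((_ - _) * _); apply: eq_big_nat => k /andP[_ kn].
by rewrite nth_ps_linv_seq.
Qed.

Lemma ps_linv0 a : ps_linv a 0 = 0.
Proof. by rewrite ps_linvE big_geq // /ps_X subr0 mul0r. Qed.

Lemma ps_linvK a : X0 a -> ps_comp (ps_linv a) a = ps_X.
Proof.
move=> [a0 /eqP a1]; apply/funext => -[|n]; first by rewrite ps_comp0.
rewrite /ps_comp big_nat_recr // [ps_linv a n.+1]ps_linvE ps_exp_diag //.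
by rewrite -mulrA -exprMn mulVf // expr1n mulr1; apply: subrKC.
Qed.

Lemma ps_linv_X0 a : X0 a -> X0 (ps_linv a).
Proof.
move=> [_ /eqP a1]; split; first exact: ps_linv0.
apply/eqP; rewrite ps_linvE big_geq // subr0 expr1 mul1r.
by rewrite invr_neq0.
Qed.

Definition fps0_inv (a : fps0 K) : fps0 K :=
  SigSub (mem_set (ps_linv_X0 (set_valP a))).

Definition fps0_one : fps0 K := SigSub (mem_set (@ps_X_X0 K)).

Lemma fps0_inj (a b : fps0 K) : coef a = coef b -> a = b.
Proof. exact: val_inj. Qed.

Lemma coef0 (a : fps0 K) : coef a 0 = 0.
Proof. by have [] := set_valP a. Qed.

(** A monoid in which every element has a left inverse is a group. *)
Lemma left_inverse_is_group (G : Type) (mul : G -> G -> G) e inv :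
  associative mul -> left_id e mul -> right_id e mul -> left_inverse e inv mul ->
  is_group mul e inv.
Proof.
move=> mulA mul1 mulr1 mulV; split=> // x.
by rewrite -[LHS]mul1 -{1}(mulV (inv x)) -mulA [mul (inv x) _]mulA mulV mul1 mulV.
Qed.

Lemma fps0_is_group : is_group fps0_comp fps0_one fps0_inv.
Proof.
apply: left_inverse_is_group.
- by move=> h g f; apply: fps0_inj; apply: ps_compA; apply: coef0.
- by move=> f; apply/fps0_inj/ps_comp_Xl/coef0.
- by move=> f; apply/fps0_inj/ps_comp_Xr/coef0.
- by move=> f; apply/fps0_inj/ps_linvK/set_valP.
Qed.

End Algebra.

(** * The mean value inequality over the complex numbers *)

Definition reals (K : numFieldType) : set K := [set t | t \is Num.real].
Arguments reals : clear implicits.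

Section MeanValue.
Variable K : numFieldType.

(** The order of [R[i]] compares complex numbers with the same imaginary part,
    so that [0 <= s <= 1] describes the real unit segment. One point [a] serves
    for a given [c] although [f] is not real valued, because this is only an
    inequality. *)
Definition mean_value : Prop := forall f df : K -> K^o,
  (forall s, 0 <= s <= 1 -> is_dirder (reals K) f s 1 (df s)) ->
  forall c, exists2 a, 0 <= a <= 1 & `|f 1 - f 0 - c| <= `|df a - c|.

End MeanValue.

Lemma cvg_punctured (K : numFieldType) (S : set K) T (F : set_system T)
    {FF : Filter F} (f : T -> K) :
  f @ F --> (0 : K) -> (\forall t \near F, S (f t) /\ f t != 0) ->
  f @ F --> within S (0 : K)^'.
Proof.
move=> f0 fS A; rewrite /within /dnbhs /= => /f0 fA.
suff : F (f @^-1` A) by [].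
have : F ((fun t => S (f t) /\ f t != 0) `&` (f @^-1` [set y | y != 0 -> S y -> A y])).
  exact: filterI.
by apply: filterS => t [[St t0] fAt]; exact: fAt.
Qed.

Section ComplexTopology.
Context {R : realType}.
Local Notation K := (R[i] : numFieldType).
Local Open Scope complex_scope.

Lemma Re_cvg T (F : set_system T) {FF : Filter F} (f : T -> K) (l : K) :
  f @ F --> l -> complex.Re (f t) @[t --> F] --> complex.Re l.
Proof.
move=> /cvgrPdist_lt fl; apply/cvgrPdist_lt => e e0.
have e0' : 0 < (e%:C : K) by rewrite ltcR.
have := fl _ e0'; apply: filterS => w zw; rewrite -ltcR.
by apply: le_lt_trans zw; rewrite -raddfB; exact: normc_ge_Re.
Qed.

Lemma real_complex_cvg T (F : set_system T) {FF : Filter F} (f : T -> R) (l : R) :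
  f @ F --> l -> ((f t)%:C : K) @[t --> F] --> (l%:C : K).
Proof.
move=> /cvgrPdist_lt fl; apply/cvgrPdist_lt => e; rewrite ltcE /= => /andP[/eqP e1 e0].
have := fl _ e0; apply: filterS => x lx.
rewrite -rmorphB /= normc_def /= expr0n addr0 sqrtr_sqr ltcE /= e1 eqxx.
exact: lx.
Qed.

Lemma real_complex_dnbhs : (h%:C : K) @[h --> (0 : R)^'] --> within (reals K) 0^'.
Proof.
apply: cvg_punctured.
  by apply: real_complex_cvg; exact: nbhs_dnbhs.
near=> h; split; first by apply/complex_realP; exists h.
by rewrite fmorph_eq0; near: h; exact: nbhs_dnbhs_neq.
Unshelve. all: by end_near.
Qed.

(** Projecting on the direction of [v = f 1 - f 0 - c] reduces the inequality to
    the mean value theorem for a real function: with [u = conj v / |v|], the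
    function [s |-> Re (u * (f s - s * c))] increases by exactly [|v|]. *)
Lemma complex_mean_value : mean_value K.
Proof.
move=> f df dfE c; set v := f 1 - f 0 - c.
have [->|v0] := eqVneq v 0.
  by exists 0; rewrite ?lexx ?ler01 ?normr0 ?normr_ge0.
pose u : K := v^* / `|v|.
have u1 : `|u| = 1.
  by rewrite normrM normfV normr_id normcJ divff // normr_eq0.
have uv : complex.Re (u * v) = complex.Re `|v|.
  congr complex.Re; rewrite /u mulrAC [_ * v]mulrC -sqr_normc expr2 mulfK //.
  by rewrite normr_eq0.
pose g (s : R) : R := complex.Re (u * (f s%:C - s%:C * c)).
pose dg (s : R) : R := complex.Re (u * (df s%:C - c)).
have gE (s : R) : 0 <= s <= 1 -> is_derive s 1 g (dg s).
  move=> s01.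
  have cv : h^-1 *: ((g \o shift s) (h *: 1) - g s) @[h --> 0^'] --> dg s.
    have : (u * (((h%:C : K)^-1 *: (f (s%:C + h%:C *: 1) - f s%:C)) - c) : K)
        @[h --> (0:R)^'] --> (u * (df s%:C - c) : K).
      apply: cvgM; first exact: cvg_cst.
      apply: cvgB; last exact: cvg_cst.
      have /dfE : 0 <= (s%:C : K) <= 1 by rewrite !lecE /= !eqxx.
      exact: cvg_comp real_complex_dnbhs.
    move/Re_cvg; apply: cvg_trans; apply: near_eq_cvg.
    near=> h => /=; rewrite /shift /= /g /=.
    rewrite [h *: 1]mulr1 [_%:C *: 1]mulr1 -fmorphV -raddfB -mulrBr.
    rewrite -[RHS]/(h^-1 * _).
    have ReZ (r : R) (z : R[i]) : r * complex.Re z = complex.Re (r%:C * z).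
      by case: z => z1 z2 /=; rewrite mul0r subr0.
    rewrite ReZ addrC rmorphD /=; congr complex.Re; rewrite /GRing.scale /=.
    have h0 : h != 0 by near: h; exact: nbhs_dnbhs_neq.
    have : (h^-1)%:C * h%:C = 1 :> R[i] by rewrite -rmorphM mulVf.
    set a := (h^-1)%:C; set b := h%:C; set x := s%:C.
    set y := f _; set z := f _ => ab.
    transitivity (u * a * (y - z) - u * (a * b) * c); rewrite ?ab; first ring.
    by rewrite [b + x]addrC -/y; ring: ab.
  split; first by apply/cvg_ex; exists (dg s).
  exact: cvg_lim cv.
have [||a a01 gab] := @MVT_segment R g dg 0 1 ler01.
- by move=> x; rewrite in_itv /= => /andP[x0 x1]; apply: gE; rewrite !ltW.
- apply: derivable_within_continuous => x; rewrite in_itv /= => /gE gx.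
  exact: ex_derive.
exists a%:C; first by move: a01; rewrite in_itv /= !lecE /= !eqxx.
have gv : g 1 - g 0 = complex.Re `|v|.
  by rewrite -uv /g -raddfB -mulrBr /v rmorph1 rmorph0; congr complex.Re; ring.
rewrite -[X in X <= _](@RRe_real R) ?normr_real // -gv gab subr0 mulr1.
rewrite -[X in _ <= X]mul1r -u1 -normrM; apply: le_trans (normc_ge_Re _).
by rewrite lecR ler_norm.
Unshelve. all: by end_near.
Qed.

End ComplexTopology.

(** * Convergence in initial and product topologies *)

Lemma initial_cvgP (X : choiceType) (Y : topologicalType) (f : X -> Y)
    T (G : set_system T) {FG : Filter G} (u : T -> initial_topology f)
    (x : initial_topology f) :
  u t @[t --> G] --> x <-> f (u t) @[t --> G] --> f x.
Proof.
split=> [ux|fux].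
  by apply: (cvg_comp _ _ ux); exact: initial_continuous.
move=> A [B [[C oC <-] Cx] BA].
have /fux : nbhs (f x) C by exact: open_nbhs_nbhs.
suff : G [set t | C (f (u t))] -> G [set t | A (u t)] by [].
by apply: filterS => t; exact: BA.
Qed.

Lemma open_setX (X Y : topologicalType) (A : set X) (B : set Y) :
  open A -> open B -> open (A `*` B).
Proof.
rewrite !openE => oA oB [x y] [/= Ax By].
by exists (A, B) => //=; split; [exact: oA|exact: oB].
Qed.

Lemma ptws_cvgP (I : Type) (Y : topologicalType) T (G : set_system T)
    {FG : Filter G} (u : T -> {ptws I -> Y}) (x : {ptws I -> Y}) :
  u t @[t --> G] --> x <-> forall i, u t i @[t --> G] --> x i.
Proof.
split=> [/cvg_sup ux i|ux].
  by have /initial_cvgP := ux i; apply.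
by apply/cvg_sup => i; apply/initial_cvgP; exact: ux.
Qed.

(** * Smoothness in terms of filters *)

(** Joint continuity of [(h_1, .., h_k, x) |-> D [:: h_1; ..; h_k] x] on
    [E ^ k * U], for all k at once, along arbitrary filters. Directions come as
    an arbitrary family [h i] read along a list [s] of indices, so that lists
    built from other lists need no reindexing by ordinals. *)
Definition jointly_continuous (K : numFieldType) (E F : preTopologicalLmodType K) (U : set E)
    (D : seq E -> E -> F) : Prop :=
  forall (T : Type) (G : set_system T), Filter G ->
  forall (I : Type) (s : seq I) (h : I -> T -> E) (l : I -> E) (x : T -> E) (x0 : E),
  U x0 -> x t @[t --> G] --> x0 -> (forall i, h i t @[t --> G] --> l i) ->
  D [seq h i t | i <- s] (x t) @[t --> G] --> D [seq l i | i <- s] x0.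

Lemma jointly_continuous_cst (K : numFieldType) (E F : preTopologicalLmodType K) (U : set E)
    (D : seq E -> E -> F) T (G : set_system T) {FG : Filter G} (hs : seq E)
    (x : T -> E) (x0 : E) : jointly_continuous U D -> U x0 -> x t @[t --> G] --> x0 ->
  D hs (x t) @[t --> G] --> D hs x0.
Proof.
move=> Dc Ux0 xx0.
have := Dc T G FG E hs (fun i _ => i) id x x0 Ux0 xx0 (fun i => cvg_cst i).
by rewrite /= !map_id => Dx; exact: Dx.
Qed.

(** The part of smoothness that speaks of the family of derivatives alone; it is
    the form in which families are combined. *)
Definition smooth_data (K : numFieldType) (S : set K)
    (E F : preTopologicalLmodType K) (U : set E) (D : seq E -> E -> F) : Prop :=
  [/\ open U,
      forall (hs : seq E) (h x : E), U x ->
        is_dirder S (D hs) x h (D (h :: hs) x) &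
      jointly_continuous U D].

Section SmoothOn.
Context {K : numFieldType} (S : set K) (E F : preTopologicalLmodType K).

Lemma smooth_onP (U : set E) (f : E -> F) :
  smooth_on S U f <->
  exists2 D, smooth_data S U D & forall x, U x -> D [::] x = f x.
Proof.
split=> [[oU [D [D0 Dd Dc]]]|[D [oU Dd Dc] D0]].
  exists D => //; split=> // T G FG I s h l x x0 Ux0 xx0 hl.
  (* Directions [h i] along [s] become a function on ordinals, as positions in
     [s]. *)
  pose k := size s; pose i0 (j : 'I_k) : I := tnth (in_tuple s) j.
  pose p t : E * {ptws 'I_k -> E} := (x t, fun j => h (i0 j) t).
  pose p0 : E * {ptws 'I_k -> E} := (x0, fun j => l (i0 j)).
  have E1 (u : I -> E) : codom (fun j : 'I_k => u (i0 j)) = [seq u i | i <- s].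
    by rewrite codomE (map_comp u i0) map_tnth_enum.
  have pc : p t @[t --> G] --> p0.
    have pc2 : (p t).2 @[t --> G] --> p0.2 by apply/ptws_cvgP => j; exact: hl.
    exact: cvg_pair xx0 pc2.
  have oW : open (U `*` [set: {ptws 'I_k -> E}]) by exact: open_setX oU openT.
  have := Dc k; rewrite continuous_open_subspace // => /(_ p0).
  rewrite inE => /(_ (conj Ux0 Logic.I)) Dp0.
  have -> : (fun t => D [seq h i t | i <- s] (x t)) =
            (fun q : E * {ptws 'I_k -> E} => D (codom q.2) q.1) \o p.
    by apply/funext => t; rewrite -(E1 (h^~ t)).
  by rewrite -E1; exact: cvg_comp pc Dp0.
split=> //; exists D; split=> // k.
rewrite continuous_open_subspace => [|]; last exact: open_setX oU openT.
move=> p0; rewrite inE => -[Up0 _].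
have := Dc _ (nbhs p0) _ 'I_k (enum 'I_k) (fun i p => p.2 i) p0.2 fst p0.1 Up0.
rewrite -codomE => /(_ _ cvg_fst) Dp0.
have p0i i : p.2 i @[p --> p0] --> p0.2 i.
  by move: i; apply/ptws_cvgP; exact: cvg_snd.
move: (Dp0 p0i); apply: cvg_trans; apply: near_eq_cvg.
by apply: nearW => p; rewrite codomE.
Qed.

End SmoothOn.

(** * Strict differentiability *)

Definition tvs_axiom (K : numFieldType) (E : preTopologicalLmodType K) : Prop :=
  continuous (fun z : E * E => z.1 + z.2) /\
  continuous (fun z : K^o * E => z.1 *: z.2).

(** What the real scalars and the full field have in common. *)
Definition scalar_set (K : numFieldType) (S : set K) : Prop :=
  [/\ reals K `<=` S, forall s t, S s -> S t -> S (s * t) &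
      forall s, S s -> S s^-1].

Lemma tvs_cvg (K : numFieldType) (E : preTopologicalLmodType K)
    T (G : set_system T) {FG : Filter G} (a : T -> K) (x y : T -> E) (a0 : K) (x0 y0 : E) :
  tvs_axiom E -> a t @[t --> G] --> a0 -> x t @[t --> G] --> x0 ->
  y t @[t --> G] --> y0 -> x t + a t *: y t @[t --> G] --> x0 + a0 *: y0.
Proof.
move=> [cD cZ] aa xx yy.
have cay : a t *: y t @[t --> G] --> a0 *: y0.
  exact: cvg_comp (cvg_pair aa yy) (cZ (a0, y0)).
exact: cvg_comp (cvg_pair xx cay) (cD (x0, _)).
Qed.

Section StrictDerivative.
Context {K : numFieldType} (S : set K).
Hypotheses (mvK : mean_value K) (SS : scalar_set S).

Section ScalarValued.
Context (E : preTopologicalLmodType K) (U : set E) (D : seq E -> E -> K^o).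
Hypotheses (tvsE : tvs_axiom E) (sD : smooth_data S U D).

(** The mean value inequality for [s |-> D hs (y + s t k) / t] on the real
    segment: its derivative is [D (k :: hs)], as [r t] runs through scalars in [S]
    when [r] is real. *)
Lemma mean_value_segment (hs : seq E) (y k : E) (t c : K) :
  S t -> t != 0 -> (forall s, 0 <= s <= 1 -> U (y + (s * t) *: k)) ->
  exists2 s, 0 <= s <= 1 &
    `|t^-1 * (D hs (y + t *: k) - D hs y) - c| <=
    `|D (k :: hs) (y + (s * t) *: k) - c|.
Proof.
have [_ Dd _] := sD; have [rS MS _] := SS => St t0 yU.
pose f (s : K) : K^o := t^-1 * D hs (y + (s * t) *: k).
pose df (s : K) : K^o := D (k :: hs) (y + (s * t) *: k).
have fdf s : 0 <= s <= 1 -> is_dirder (reals K) f s 1 (df s).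
  move=> s01; rewrite /is_dirder.
  have rt : r * t @[r --> within (reals K) (0 : K)^'] --> within S (0 : K)^'.
    have r0 : (r : K) @[r --> within (reals K) (0 : K)^'] --> (0 : K).
      by apply: cvg_trans (cvg_within _) _; exact: nbhs_dnbhs.
    apply: cvg_punctured.
      have : r * t @[r --> within (reals K) (0 : K)^'] --> (0 * t : K).
        by apply: cvgM r0 _; exact: cvg_cst.
      by rewrite mul0r.
    rewrite near_withinE; near=> r => rR; split; first exact/MS/St/rS.
    by rewrite mulf_neq0 //; near: r; exact: nbhs_dnbhs_neq.
  have := cvg_comp _ _ rt (Dd hs k _ (yU s s01)).
  apply: cvg_trans; apply: near_eq_cvg; apply: nearW => r /=.
  rewrite /f [r *: 1]mulr1 -addrA -scalerDl -mulrDl [s + r]addrC.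
  by rewrite -mulrBr invfM -[RHS]/(r^-1 * _) mulrA.
have [s s01 le] := mvK fdf c; exists s => //; apply: le_trans le.
by rewrite /f mul1r mul0r scale0r addr0 mulrBr.
Unshelve. all: by end_near.
Qed.

(** The derivative that [mean_value_segment] compares the quotient with is taken
    at points that tend to [y0], so it tends to the limit by joint continuity. No
    convexity of neighbourhoods is needed: if the points are picked by choice
    functions, [sg t * tau t] tends to [0] whatever the choice. *)
Lemma strict_derivative T (G : set_system T) {FG : Filter G} (tau : T -> K)
    (y k : T -> E) (y0 k0 : E) (I : Type) (s : seq I) (h : I -> T -> E) (l : I -> E) :
  U y0 -> (\forall t \near G, S (tau t) /\ tau t != 0) -> tau t @[t --> G] --> (0 : K) ->
  y t @[t --> G] --> y0 -> k t @[t --> G] --> k0 ->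
  (forall i, h i t @[t --> G] --> l i) ->
  (tau t)^-1 *: (D [seq h i t | i <- s] (y t + tau t *: k t)
                 - D [seq h i t | i <- s] (y t)) @[t --> G]
    --> D (k0 :: [seq l i | i <- s]) y0.
Proof.
have [oU Dd Dc] := sD; move=> Uy0 Stau tau0 yy kk hl.
(* Points chosen on the segments [y t, y t + tau t * k t] converge to [y0],
   however they are chosen. *)
have seg (sg : T -> K) : (forall t, 0 <= sg t <= 1) ->
    y t + (sg t * tau t) *: k t @[t --> G] --> y0.
  move=> sg01; rewrite -[y0]addr0 -(scale0r k0); apply: tvs_cvg => //.
  apply/cvgrPdist_lt => e e0; move/cvgrPdist_lt: tau0 => /(_ e e0).
  apply: filterS => t; rewrite !sub0r !normrN normrM; apply: le_lt_trans.
  have /andP[sg0 sg1] := sg01 t.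
  by rewrite ger0_norm // ler_piMl.
(* Choosing a point outside [U] whenever there is one shows that eventually
   there is none. *)
have segU : \forall t \near G, forall r, 0 <= r <= 1 -> U (y t + (r * tau t) *: k t).
  pose bad t r := 0 <= r <= 1 /\ ~ U (y t + (r * tau t) *: k t).
  pose sg t := xget 0 (bad t).
  have sg01 t : 0 <= sg t <= 1.
    by rewrite /sg; case: xgetP => [r _ []//|_]; rewrite lexx ler01.
  have : \forall t \near G, U (y t + (sg t * tau t) *: k t).
    exact: seg sg01 U (open_nbhs_nbhs (conj oU Uy0)).
  apply: filterS => t; rewrite /sg; case: xgetP => [r _ []//|nb _ r r01].
  by apply: contrapT => nU; exact: (nb r).
pose Q t := (tau t)^-1 * (D [seq h i t | i <- s] (y t + tau t *: k t)
                 - D [seq h i t | i <- s] (y t)).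
pose c := D (k0 :: [seq l i | i <- s]) y0.
pose good t r := 0 <= r <= 1 /\ `|Q t - c| <=
   `|D (k t :: [seq h i t | i <- s]) (y t + (r * tau t) *: k t) - c|.
pose sg t := xget 0 (good t).
have sg01 t : 0 <= sg t <= 1.
  by rewrite /sg; case: xgetP => [r _ []//|_]; rewrite lexx ler01.
have sgP : \forall t \near G, good t (sg t).
  move: Stau segU; apply: filterS2 => t [St t0] tU.
  have [r r01 rle] := mean_value_segment [seq h i t | i <- s] c St t0 tU.
  by rewrite /sg; case: xgetP => // /(_ r) [].
pose h' (o : option I) t := if o is Some i then h i t else k t.
pose l' (o : option I) := if o is Some i then l i else k0.
have hl' o : h' o t @[t --> G] --> l' o by case: o.
have := Dc T G FG (option I) (None :: map Some s) h' l' _ _ Uy0 (seg sg sg01) hl'.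
rewrite /= -map_comp /= => /cvgrPdist_lt Dc'; apply/cvgrPdist_lt => e e0.
move: sgP (Dc' _ e0); apply: filterS2 => t [_ le].
rewrite -map_comp distrC => lt; rewrite distrC; exact: le_lt_trans lt.
Qed.

Lemma strict_derivative_cst T (G : set_system T) {FG : Filter G} (tau : T -> K)
    (y k : T -> E) (y0 k0 : E) (hs : seq E) :
  U y0 -> (\forall t \near G, S (tau t) /\ tau t != 0) -> tau t @[t --> G] --> (0 : K) ->
  y t @[t --> G] --> y0 -> k t @[t --> G] --> k0 ->
  (tau t)^-1 *: (D hs (y t + tau t *: k t) - D hs (y t)) @[t --> G]
    --> D (k0 :: hs) y0.
Proof.
move=> Uy0 Stau tau0 yy kk.
have := @strict_derivative T G FG tau y k y0 k0 E hs (fun i _ => i) id Uy0 Stau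
  tau0 yy kk (fun i => cvg_cst i).
by rewrite /= !map_id => Dk; exact: (Dk FG).
Qed.

End ScalarValued.
End StrictDerivative.

(** * Linearity of the iterated derivatives *)

Section ScalarLimits.
Context {K : numFieldType} (S : set K).
Hypothesis SS : scalar_set S.

Lemma scalar_limit_proper : ProperFilter (within S (0 : K)^').
Proof.
have [rS _ _] := SS; apply: Build_ProperFilter_ex => A A0; apply: contrapT => Ax.
have /nbhs_ballP[e /= e0 eA] := A0.
have e2 : 0 < e / 2 by rewrite divr_gt0.
apply: Ax; exists (e / 2); apply: eA.
- rewrite /ball /= sub0r normrN gtr0_norm //.
  by rewrite gtr_pMr // invf_lt1 ?ltr1n.
- by rewrite gt_eqF.
- by apply: rS; rewrite /reals /= gtr0_real.
Qed.

Lemma scalar_limit0 : t @[t --> within S (0 : K)^'] --> (0 : K).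
Proof. by apply: cvg_trans (cvg_within _) _; exact: nbhs_dnbhs. Qed.

Lemma near_scalar : \forall t \near within S (0 : K)^', S t /\ t != 0.
Proof.
rewrite near_withinE; near=> t => St; split=> //.
by near: t; exact: nbhs_dnbhs_neq.
Unshelve. all: by end_near.
Qed.

Lemma line_cvg (E : preTopologicalLmodType K) (x h : E) : tvs_axiom E ->
  x + t *: h @[t --> within S (0 : K)^'] --> x.
Proof.
move=> tvsE; have : x + t *: h @[t --> within S (0 : K)^'] --> x + 0 *: h.
  by apply: (tvs_cvg tvsE scalar_limit0); exact: cvg_cst.
by rewrite scale0r addr0.
Qed.

Lemma near_line (E : preTopologicalLmodType K) (U : set E) (x h : E) :
  tvs_axiom E -> open U -> U x -> \forall t \near within S (0 : K)^', U (x + t *: h).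
Proof.
move=> tvsE oU Ux.
exact: (line_cvg h tvsE (open_nbhs_nbhs (conj oU Ux))).
Qed.

Lemma dirder_unique (E : preTopologicalLmodType K) (f : E -> K^o) (x h : E) d d' :
  is_dirder S f x h d -> is_dirder S f x h d' -> d = d'.
Proof.
have := scalar_limit_proper => ?; apply: cvg_unique; exact: norm_hausdorff.
Qed.

Lemma near_eq_dirder (E F : preTopologicalLmodType K) (U : set E) (f g : E -> F)
    (x h : E) (d : F) :
  tvs_axiom E -> open U -> U x -> (forall y, U y -> f y = g y) ->
  is_dirder S f x h d -> is_dirder S g x h d.
Proof.
move=> tvsE oU Ux fg; apply: cvg_trans; apply: near_eq_cvg.
have := near_line h tvsE oU Ux; apply: filterS => t Ut /=.
by rewrite !fg.
Qed.

Lemma dirderD (E : preTopologicalLmodType K) (f g : E -> K^o) (x h : E) d d' :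
  is_dirder S f x h d -> is_dirder S g x h d' ->
  is_dirder S (fun y => f y + g y) x h (d + d').
Proof.
move=> fd gd; apply: cvg_trans _ (cvgD fd gd); apply: near_eq_cvg.
apply: nearW => t /=.
by rewrite -[LHS]/(_ *: _ + _ *: _) -scalerDr opprD addrACA.
Qed.

Lemma dirderZ (E : preTopologicalLmodType K) (f : E -> K^o) (a : K) (x h : E) d :
  is_dirder S f x h d -> is_dirder S (fun y => a * f y) x h (a * d).
Proof.
move=> fd; apply: cvg_trans _ (cvgM (cvg_cst a) fd); apply: near_eq_cvg.
by apply: nearW => t /=; rewrite -mulrBr -[RHS]/(t^-1 * _) mulrCA.
Qed.

End ScalarLimits.

Section Multilinear.
Context {K : numFieldType} (S : set K).
Hypotheses (mvK : mean_value K) (SS : scalar_set S).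
Context (E : preTopologicalLmodType K) (U : set E) (D : seq E -> E -> K^o).
Hypotheses (tvsE : tvs_axiom E) (sD : smooth_data S U D).

(** The increment along [k + a k'] is the increment along [k] followed by one
    along [k'] that starts at the moving point [x + t k]; strict differentiability
    gives the limit of the second quotient. *)
Lemma iterated_derivative_head (hs : seq E) (x k k' : E) (a : K) : U x -> S a ->
  D ((k + a *: k') :: hs) x = D (k :: hs) x + a * D (k' :: hs) x.
Proof.
have [oU Dd _] := sD; have [_ MS _] := SS => Ux Sa.
apply: (dirder_unique SS (Dd _ _ _ Ux)).
pose F := within S (0 : K)^'.
have xk : x + t *: k @[t --> F] --> x by exact: line_cvg.
have [->|a0] := eqVneq a 0.
  by rewrite scale0r mul0r !addr0; exact: Dd.
have at0 : a * t @[t --> F] --> (0 : K).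
  have : a * t @[t --> F] --> (a * 0 : K).
    by apply: cvgM; [exact: cvg_cst|exact: scalar_limit0].
  by rewrite mulr0.
have Sat : \forall t \near F, S (a * t) /\ a * t != 0.
  have := near_scalar S; apply: filterS => t [St t0].
  by split; [exact: MS|rewrite mulf_neq0].
have Dk' : (a * t)^-1 *: (D hs (x + t *: k + (a * t) *: k') - D hs (x + t *: k))
    @[t --> F] --> D (k' :: hs) x.
  by apply: (strict_derivative_cst mvK SS tvsE sD Ux Sat at0 xk); exact: cvg_cst.
have DD : t^-1 *: (D hs (x + t *: k) - D hs x) + a *: ((a * t)^-1 *:
    (D hs (x + t *: k + (a * t) *: k') - D hs (x + t *: k))) @[t --> F]
    --> D (k :: hs) x + a *: D (k' :: hs) x.
  by apply: cvgD (Dd hs k _ Ux) _; apply: cvgZ; [exact: cvg_cst|exact: Dk'].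
apply: cvg_trans _ DD; apply: near_eq_cvg; apply: nearW => t.
rewrite -[t^-1 *: _]/(t^-1 * _) -[a *: _]/(a * (_ * _)) -[RHS]/(_ * _).
rewrite invfM [a * _]mulrA mulrA divff // mul1r -mulrDr.
by congr (_ * _); rewrite addrC addrA subrK scalerDr addrA scalerA [a * t]mulrC.
Qed.

(** In a later direction the identity holds on all of the open set [U] and can
    be differentiated along the directions before it. *)
Lemma iterated_derivative_linear (pre hs : seq E) (x k k' : E) (a : K) :
  U x -> S a ->
  D (pre ++ (k + a *: k') :: hs) x =
  D (pre ++ k :: hs) x + a * D (pre ++ k' :: hs) x.
Proof.
have [oU Dd _] := sD => Ux Sa.
elim: pre x Ux => [|p pre IH] x Ux /=; first exact: iterated_derivative_head.
apply: (dirder_unique SS (Dd _ _ _ Ux)).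
apply: (near_eq_dirder tvsE oU Ux (fun y Uy => esym (IH y Uy))).
by apply: dirderD; [exact: Dd|apply: dirderZ; exact: Dd].
Qed.

End Multilinear.

(** * The chain rule *)

(** The derivatives of [g \o f] are sums over the partitions of the list of
    directions. Differentiating once more in a direction [h] either
    differentiates [g], which makes [h] a block of its own, or one of the
    derivatives of [f], which adds [h] to an existing block. *)
Fixpoint prepend_one (T : Type) (h : T) (P : seq (seq T)) : seq (seq (seq T)) :=
  if P is B :: P' then
    ((h :: B) :: P') :: [seq B :: Q | Q <- prepend_one h P'] else [::].

Fixpoint set_partitions (T : Type) (hs : seq T) : seq (seq (seq T)) :=
  if hs is h :: hs' then
    flatten [seq ([:: h] :: P) :: prepend_one h P | P <- set_partitions hs']
  else [:: [::]].

Lemma map_prepend_one (T T' : Type) (u : T -> T') (h : T) (P : seq (seq T)) :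
  prepend_one (u h) (map (map u) P) = map (map (map u)) (prepend_one h P).
Proof. by elim: P => //= B P ->; congr (_ :: _); rewrite -!map_comp. Qed.

(** Partitions depend on positions only. This lets joint continuity be checked
    for one partition of the indices at a time. *)
Lemma map_set_partitions (T T' : Type) (u : T -> T') (hs : seq T) :
  set_partitions (map u hs) = map (map (map u)) (set_partitions hs).
Proof.
elim: hs => //= h hs ->; rewrite map_flatten -!map_comp; congr flatten.
by apply: eq_map => P /=; rewrite map_prepend_one.
Qed.

Lemma cvg_sum_seq (K : numFieldType) T (G : set_system T) {FG : Filter G}
    (J : Type) (r : seq J) (f : J -> T -> K^o) (l : J -> K^o) :
  (forall j, f j t @[t --> G] --> l j) ->
  \sum_(j <- r) f j t @[t --> G] --> \sum_(j <- r) l j.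
Proof.
move=> fl; elim: r => [|j r IH].
  rewrite big_nil; under eq_fun do rewrite big_nil; exact: cvg_cst.
rewrite big_cons; under eq_fun do rewrite big_cons; exact: cvgD.
Qed.

Section ChainRule.
Context {K : numFieldType} (S : set K).
Hypotheses (mvK : mean_value K) (SS : scalar_set S).
Context (E F : preTopologicalLmodType K) (U : set E) (V : set F).
Context (Df : seq E -> E -> F) (Dg : seq F -> F -> K^o).
Hypotheses (tvsE : tvs_axiom E) (tvsF : tvs_axiom F).
Hypotheses (sf : smooth_data S U Df) (sg : smooth_data S V Dg).
Hypothesis fUV : forall x, U x -> V (Df [::] x).

(** The product rule for the directions fed to [Dg], at a fixed base point. The
    directions are moved one after the other; [pre] holds those already moved. *)
Lemma dirder_prepend_one (x h : E) (y : F) (pre : seq F) (P : seq (seq E)) :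
  U x -> V y ->
  is_dirder S (fun z => Dg (pre ++ [seq Df B z | B <- P]) y) x h
    (\sum_(Q <- prepend_one h P) Dg (pre ++ [seq Df B x | B <- Q]) y).
Proof.
have [oU Dfd Dfc] := sf; have [oV Dgd Dgc] := sg => Ux Vy.
have xh : x + t *: h @[t --> within S (0 : K)^'] --> x by exact: line_cvg.
elim: P pre => [|B P IH] pre /=.
  rewrite big_nil /is_dirder; under eq_fun do rewrite subrr scaler0.
  exact: cvg_cst.
rewrite big_cons big_map.
(* By linearity of [Dg], moving the first block changes the value by [t] times
   the value with the difference quotient [q t] in its place. The directions
   form one converging family: constants, moving blocks, and [q t]. *)
pose q t := t^-1 *: (Df B (x + t *: h) - Df B x).
pose I := option (F + seq E).
pose s : seq I := map (Some \o inl) pre ++ None :: map (Some \o inr) P.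
pose hh (i : I) t := match i with
  None => q t | Some (inl k) => k | Some (inr C) => Df C (x + t *: h) end.
pose ll (i : I) := match i with
  None => Df (h :: B) x | Some (inl k) => k | Some (inr C) => Df C x end.
have hl i : hh i t @[t --> within S (0 : K)^'] --> ll i.
  by case: i => [[k|C]|]; [exact: cvg_cst|exact: jointly_continuous_cst Dfc Ux xh|exact: Dfd].
have sE (u : I -> F) : [seq u i | i <- s] =
    [seq u (Some (inl k)) | k <- pre] ++ u None :: [seq u (Some (inr C)) | C <- P].
  by rewrite /s map_cat /= -!map_comp.
have qc : Dg (pre ++ q t :: [seq Df C (x + t *: h) | C <- P]) y
    @[t --> within S (0 : K)^'] --> Dg (pre ++ Df (h :: B) x :: [seq Df C x | C <- P]) y.
  have : Dg [seq hh i t | i <- s] y @[t --> within S (0 : K)^'] -->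
      Dg [seq ll i | i <- s] y.
    by apply: (Dgc _ _ _ I s hh ll (cst y)) => //; exact: cvg_cst.
  rewrite sE /= map_id; apply: cvg_trans; apply: near_eq_cvg.
  by apply: nearW => t; rewrite sE /= map_id.
have IHc : is_dirder S (fun z => Dg (pre ++ Df B x :: [seq Df C z | C <- P]) y) x h
    (\sum_(Q <- prepend_one h P) Dg (pre ++ Df B x :: [seq Df C x | C <- Q]) y).
  under eq_fun do rewrite -cat_rcons.
  by under eq_bigr do rewrite -cat_rcons; exact: IH.
rewrite /is_dirder in IHc *; apply: cvg_trans _ (cvgD qc IHc).
apply: near_eq_cvg; have := near_scalar S; apply: filterS => t [St t0].
rewrite -[LHS]/(_ + _).
have -> : Df B (x + t *: h) = Df B x + t *: q t.
  by rewrite /q scalerA divff // scale1r subrKC.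
rewrite (iterated_derivative_linear mvK SS tvsF sg) // -[in LHS]/(_ * _).
by rewrite -[RHS]/(_ * _) addrAC mulrDr mulKf // addrC.
Qed.

Definition chain_data (hs : seq E) (x : E) : K^o :=
  \sum_(P <- set_partitions hs) Dg [seq Df B x | B <- P] (Df [::] x).

(** The base point [f x] moves by [t] times a converging quotient, so strict
    differentiability of [g] yields the term with the new block [[:: h]]; the
    directions yield the other terms. *)
Lemma chain_smooth_data : smooth_data S U chain_data.
Proof.
have [oU Dfd Dfc] := sf; have [oV Dgd Dgc] := sg.
split=> // [hs h x Ux|T G FG I s h l x x0 Ux0 xx0 hl]; last first.
  rewrite /chain_data map_set_partitions big_map.
  under eq_fun do rewrite map_set_partitions big_map.
  apply: cvg_sum_seq => P; rewrite -map_comp.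
  under eq_fun do rewrite -map_comp.
  apply: (Dgc T G FG _ P (fun B t => Df [seq h i t | i <- B] (x t))
    (fun B => Df [seq l i | i <- B] x0)); first exact: fUV.
  - exact: (Dfc T G FG _ [::] h l).
  - by move=> B; exact: Dfc.
rewrite /chain_data /= /is_dirder big_flatten big_map.
have H P : is_dirder S (fun z => Dg [seq Df B z | B <- P] (Df [::] z)) x h
   (\sum_(Q <- ([:: h] :: P) :: prepend_one h P) Dg [seq Df B x | B <- Q] (Df [::] x)).
  have xh : x + t *: h @[t --> within S (0 : K)^'] --> x by exact: line_cvg.
  have hl B : Df B (x + t *: h) @[t --> within S (0 : K)^'] --> Df B x.
    exact: jointly_continuous_cst Dfc Ux xh.
  pose k t := t^-1 *: (Df [::] (x + t *: h) - Df [::] x).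
  have Dk : t^-1 *: (Dg [seq Df B (x + t *: h) | B <- P] (Df [::] x + t *: k t)
        - Dg [seq Df B (x + t *: h) | B <- P] (Df [::] x))
      @[t --> within S (0 : K)^']
      --> Dg (Df [:: h] x :: [seq Df B x | B <- P]) (Df [::] x).
    apply: (strict_derivative mvK SS tvsF sg (fUV Ux) (near_scalar S)
      (scalar_limit0 S) (cvg_cst _) (Dfd [::] h x Ux) hl).
  rewrite big_cons.
  have := dirder_prepend_one (h := h) (pre := [::]) (P := P) Ux (fUV Ux).
  rewrite /is_dirder /= => Dp.
  apply: cvg_trans _ (cvgD Dk Dp).
  apply: near_eq_cvg; have := near_scalar S; apply: filterS => t [St t0].
  rewrite -[LHS]/(_ + _) -scalerDr addrA subrK; congr (_ *: (Dg _ _ - _)).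
  by rewrite /k scalerA divff // scale1r subrKC.
have big_chain (r : seq (seq (seq E))) :
    is_dirder S (fun z => \sum_(P <- r) Dg [seq Df B z | B <- P] (Df [::] z)) x h
      (\sum_(P <- r) \sum_(Q <- ([:: h] :: P) :: prepend_one h P)
         Dg [seq Df B x | B <- Q] (Df [::] x)).
  have Hs : \sum_(P <- r) t^-1 *: (Dg [seq Df B (x + t *: h) | B <- P]
        (Df [::] (x + t *: h)) - Dg [seq Df B x | B <- P] (Df [::] x))
      @[t --> within S (0 : K)^'] -->
      \sum_(P <- r) \sum_(Q <- ([:: h] :: P) :: prepend_one h P)
        Dg [seq Df B x | B <- Q] (Df [::] x).
    by apply: cvg_sum_seq => P; exact: H.
  apply: cvg_trans _ Hs; apply: near_eq_cvg.
  by apply: nearW => t; rewrite -scaler_sumr -sumrB.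
by have := big_chain (set_partitions hs).
Qed.

End ChainRule.

(** * Smoothness of rational functions of the coordinates *)

Section Rational.
Context {K : numFieldType} (S : set K) (E : preTopologicalLmodType K).
Context (J : Type) (lin : J -> E -> K^o) (j0 : J) (U : set E).

(** Formal rational functions of a point and of finitely many directions, with
    the functionals [lin j] as coordinates. In [RDir m j] the direction [m] is
    counted from the latest one, as in the lists of iterated derivatives. The only
    denominator is [lin j0], which is all that the inverse of a series needs. *)
Inductive rexpr : Type :=
| RCst of K
| RLin of J
| RInv
| RDir of nat & J
| RAdd of rexpr & rexpr
| RMul of rexpr & rexpr.

Fixpoint reval (e : rexpr) (hs : seq E) (x : E) : K^o :=
  match e with
  | RCst c => c
  | RLin j => lin j x
  | RInv => (lin j0 x)^-1
  | RDir m j => lin j (nth 0 hs m)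
  | RAdd e1 e2 => reval e1 hs x + reval e2 hs x
  | RMul e1 e2 => reval e1 hs x * reval e2 hs x
  end.

Fixpoint rshift (e : rexpr) : rexpr :=
  match e with
  | RDir m j => RDir m.+1 j
  | RAdd e1 e2 => RAdd (rshift e1) (rshift e2)
  | RMul e1 e2 => RMul (rshift e1) (rshift e2)
  | _ => e
  end.

Fixpoint rderiv (e : rexpr) : rexpr :=
  match e with
  | RCst _ => RCst 0
  | RLin j => RDir 0 j
  | RInv => RMul (RCst (-1)) (RMul (RDir 0 j0) (RMul RInv RInv))
  | RDir _ _ => RCst 0
  | RAdd e1 e2 => RAdd (rderiv e1) (rderiv e2)
  | RMul e1 e2 =>
      RAdd (RMul (rderiv e1) (rshift e2)) (RMul (rshift e1) (rderiv e2))
  end.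

(** A new direction at the head of the list renumbers the earlier ones. *)
Lemma reval_shift e h hs x : reval (rshift e) (h :: hs) x = reval e hs x.
Proof. by elim: e => //= e1 -> e2 ->. Qed.

Hypotheses (SS : scalar_set S) (tvsE : tvs_axiom E) (oU : open U).
Hypothesis linP : forall j x a y, lin j (x + a *: y) = lin j x + a * lin j y.
Hypothesis linC : forall j, continuous (lin j).
Hypothesis lin0 : forall x, U x -> lin j0 x != 0.

Lemma lin_cvg j T (G : set_system T) {FG : Filter G} (y : T -> E) (y0 : E) :
  y t @[t --> G] --> y0 -> lin j (y t) @[t --> G] --> lin j y0.
Proof. by move=> yy0; exact: cvg_comp yy0 (@linC j y0). Qed.

Lemma reval_jointly_continuous e : jointly_continuous U (reval e).
Proof.
move=> T G FG I s h l x x0 Ux0 xx0 hl.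
elim: e => /= [c|j||m j|e1 IH1 e2 IH2|e1 IH1 e2 IH2].
- exact: cvg_cst.
- exact: lin_cvg.
- by apply: (@cvgV K); [exact: lin0|exact: lin_cvg].
- apply: lin_cvg; elim: s m => [|i s IHs] [|m] //=; exact: cvg_cst.
- exact: cvgD.
- exact: (@cvgM K).
Qed.

Lemma reval_dirder e hs (x h : E) : U x ->
  is_dirder S (reval e hs) x h (reval (rderiv e) (h :: hs) x).
Proof.
move=> Ux; rewrite /is_dirder.
have xh : x + t *: h @[t --> within S (0 : K)^'] --> x by exact: line_cvg.
have nS := near_scalar S.
elim: e => /= [c|j||m j|e1 IH1 e2 IH2|e1 IH1 e2 IH2].
- under eq_fun do rewrite subrr scaler0; exact: cvg_cst.
- apply: (cvg_trans _ (@cvg_cst K^o (lin j h) K (within S (0 : K)^') _)); apply: near_eq_cvg.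
  move: nS; apply: filterS => t [_ t0].
  by rewrite linP addrC addKr -[RHS]/(_ * _) mulKf.
- have c : -1 * (lin j0 h * ((lin j0 (x + t *: h))^-1 * (lin j0 x)^-1))
      @[t --> within S (0 : K)^'] -->
      (-1 * (lin j0 h * ((lin j0 x)^-1 * (lin j0 x)^-1)) : K).
    apply: (@cvgM K); first exact: cvg_cst.
    apply: (@cvgM K); first exact: cvg_cst.
    apply: (@cvgM K); last exact: cvg_cst.
    by apply: (@cvgV K); [exact: lin0|exact: lin_cvg].
  apply: cvg_trans _ c; apply: near_eq_cvg.
  move: nS (near_line S h tvsE oU Ux); apply: filterS2 => t [_ t0] Ut.
  have := lin0 Ut; have := lin0 Ux; rewrite linP => a0 b0.
  rewrite -[RHS]/(_ * _); field.
  by rewrite t0 a0 b0.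
- under eq_fun do rewrite subrr scaler0; exact: cvg_cst.
- apply: cvg_trans _ (cvgD IH1 IH2); apply: near_eq_cvg; apply: nearW => t.
  by rewrite -[LHS]/(_ + _) -scalerDr; congr (_ *: _); rewrite opprD addrACA.
- rewrite !reval_shift.
  have xc : reval e1 hs (x + t *: h) @[t --> within S (0 : K)^'] --> reval e1 hs x.
    exact: jointly_continuous_cst (@reval_jointly_continuous e1) Ux xh.
  have c : t^-1 * (reval e1 hs (x + t *: h) - reval e1 hs x) * reval e2 hs x +
      reval e1 hs (x + t *: h) * (t^-1 * (reval e2 hs (x + t *: h) - reval e2 hs x))
      @[t --> within S (0 : K)^'] -->
      (reval (rderiv e1) (h :: hs) x * reval e2 hs x +
       reval e1 hs x * reval (rderiv e2) (h :: hs) x : K).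
    apply: cvgD; first by apply: (@cvgM K) IH1 _; exact: cvg_cst.
    exact: (@cvgM K).
  apply: cvg_trans _ c; apply: near_eq_cvg; apply: nearW => t.
  by rewrite -[RHS]/(_ * _); ring.
Qed.

(** The expression is evaluated without directions: [f] is a function of the
    point alone. *)
Definition rational (f : E -> K) : Prop :=
  exists e, forall x, U x -> reval e [::] x = f x.

Lemma rational_ext f g : (forall x, U x -> f x = g x) -> rational f -> rational g.
Proof. by move=> fg [e ef]; exists e => x Ux; rewrite ef ?fg. Qed.

Lemma rational_cst c : rational (fun=> c).
Proof. by exists (RCst c). Qed.

Lemma rational_lin j : rational (lin j).
Proof. by exists (RLin j). Qed.

Lemma rational_inv : rational (fun x => (lin j0 x)^-1).
Proof. by exists RInv. Qed.

Lemma rationalD f g : rational f -> rational g -> rational (fun x => f x + g x).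
Proof.
by move=> [e ef] [e' eg]; exists (RAdd e e') => x Ux /=; rewrite ef ?eg.
Qed.

Lemma rationalM f g : rational f -> rational g -> rational (fun x => f x * g x).
Proof.
by move=> [e ef] [e' eg]; exists (RMul e e') => x Ux /=; rewrite ef ?eg.
Qed.

Lemma rationalX f n : rational f -> rational (fun x => f x ^+ n).
Proof.
move=> rf; elim: n => [|n IH]; first exact: rational_cst.
by apply: rational_ext (rationalM rf IH) => x _; rewrite exprS.
Qed.

Lemma rational_sum (I : Type) (r : seq I) (P : pred I) (f : I -> E -> K) :
  (forall i, P i -> rational (f i)) -> rational (fun x => \sum_(i <- r | P i) f i x).
Proof.
move=> rf; elim: r => [|i r IH].
  by apply: rational_ext (rational_cst 0) => x _; rewrite big_nil.
case Pi: (P i); last by apply: rational_ext IH => x _; rewrite big_cons Pi.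
by apply: rational_ext (rationalD (rf i Pi) IH) => x _; rewrite big_cons Pi.
Qed.

Definition rational_data e hs := reval (iter (size hs) rderiv e) hs.

(** Formal differentiation takes expressions to expressions, and each of them
    is jointly continuous in the point and the directions. *)
Lemma rational_smooth_data e : smooth_data S U (rational_data e).
Proof.
split=> // [hs h x|T G FG I s h l x x0 Ux0 xx0 hl]; first exact: reval_dirder.
have := @reval_jointly_continuous (iter (size s) rderiv e) T G FG I s h l x x0 Ux0 xx0 hl.
rewrite /rational_data size_map; apply: cvg_trans; apply: near_eq_cvg.
by apply: nearW => t; rewrite size_map.
Qed.

End Rational.

(** * The Frechet space of sequences *)

Section SequenceSpace.
Context {K : numFieldType}.
Implicit Types (x y : seqspace K) (n : nat).

Lemma seqspace_cvgP T (G : set_system T) {FG : Filter G} (u : T -> seqspace K) x :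
  u t @[t --> G] --> x <-> forall n, u t n @[t --> G] --> x n.
Proof. exact: ptws_cvgP. Qed.

Lemma coord_cvg T (G : set_system T) {FG : Filter G} (u : T -> seqspace K) x n :
  u t @[t --> G] --> x -> u t n @[t --> G] --> x n.
Proof. by move=> /seqspace_cvgP. Qed.

Lemma coord_continuous n : continuous (fun x => x n).
Proof.
move=> x; have xx : u @[u --> x] --> x by [].
exact (@coord_cvg _ (nbhs x) _ id x n xx).
Qed.

Lemma seqspace_tvs : tvs_axiom (seqspace K).
Proof.
split=> z; have z1 : x.1 @[x --> z] --> z.1 by exact: cvg_fst.
  have z2 : x.2 @[x --> z] --> z.2 by exact: cvg_snd.
  apply/seqspace_cvgP => n.
  exact: cvgD (coord_cvg (n := n) z1) (coord_cvg (n := n) z2).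
have z2 : x.2 @[x --> z] --> z.2 by exact: cvg_snd.
apply/seqspace_cvgP => n; exact: cvgZ z1 (coord_cvg (n := n) z2).
Qed.

Lemma prod_tvs (E F : preTopologicalLmodType K) :
  tvs_axiom E -> tvs_axiom F -> tvs_axiom (E * F)%type.
Proof.
move=> [aE sE] [aF sF]; split=> z; have z1 : x.1 @[x --> z] --> z.1 by exact: cvg_fst.
  have z2 : x.2 @[x --> z] --> z.2 by exact: cvg_snd.
  have z11 : x.1.1 @[x --> z] --> z.1.1 by exact: cvg_comp z1 cvg_fst.
  have z12 : x.1.2 @[x --> z] --> z.1.2 by exact: cvg_comp z1 cvg_snd.
  have z21 : x.2.1 @[x --> z] --> z.2.1 by exact: cvg_comp z2 cvg_fst.
  have z22 : x.2.2 @[x --> z] --> z.2.2 by exact: cvg_comp z2 cvg_snd.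
  have c1 : x.1.1 + x.2.1 @[x --> z] --> z.1.1 + z.2.1.
    exact: cvg_comp (cvg_pair z11 z21) (aE (z.1.1, z.2.1)).
  have c2 : x.1.2 + x.2.2 @[x --> z] --> z.1.2 + z.2.2.
    exact: cvg_comp (cvg_pair z12 z22) (aF (z.1.2, z.2.2)).
  exact: cvg_pair c1 c2.
have z2 : x.2 @[x --> z] --> z.2 by exact: cvg_snd.
have z21 : x.2.1 @[x --> z] --> z.2.1 by exact: cvg_comp z2 cvg_fst.
have z22 : x.2.2 @[x --> z] --> z.2.2 by exact: cvg_comp z2 cvg_snd.
have c1 : x.1 *: x.2.1 @[x --> z] --> z.1 *: z.2.1.
  exact: cvg_comp (cvg_pair z1 z21) (sE (z.1, z.2.1)).
have c2 : x.1 *: x.2.2 @[x --> z] --> z.1 *: z.2.2.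
  exact: cvg_comp (cvg_pair z1 z22) (sF (z.1, z.2.2)).
exact: cvg_pair c1 c2.
Qed.

Definition sequentially_complete := forall u : nat -> K,
  (forall e : K, 0 < e -> exists N : nat, forall m n,
     (N <= m)%N -> (N <= n)%N -> `|u m - u n| < e) ->
  exists l : K, u n @[n --> \oo] --> l.

(** The sets [{y | p_i (y - x) < e for i <= n}] generate a filter that converges
    to [x] in each coordinate, so it refines the product neighbourhoods; each of
    them is a neighbourhood as a finite intersection of such. *)
Lemma seqspace_frechet : sequentially_complete -> frechet_space (seqspace K).
Proof.
move=> complK; exists (fun i x => `|x i|); split.
- move=> i; split=> [x|x y|a x]; first exact: normr_ge0.
    exact: ler_normD.
  exact: normrM.
- move=> x U; split=> [|[n [e e0 eU]]].
    pose G : set_system (seqspace K) := [set V | exists n, exists2 e : K, 0 < e &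
      forall y, (forall i, (i <= n)%N -> `|(y - x) i| < e) -> V y].
    have FG : Filter G.
      split; first by exists 0%N, 1.
        move=> A B [n [e e0 eA]] [m [d d0 dB]].
        exists (maxn n m); have [ed|de] := orP (ger_leVge (ltW e0) (ltW d0)).
          exists e => // y yx; split; first by apply: eA => i ni; apply: yx; lia.
          by apply: dB => i mi; apply: lt_le_trans ed; apply: yx; lia.
        exists d => // y yx; split; last by apply: dB => i ni; apply: yx; lia.
        by apply: eA => i mi; apply: lt_le_trans de; apply: yx; lia.
      by move=> A B AB [n [e e0 eA]]; exists n, e => // y /eA/AB.
    suff : y @[y --> G] --> x by apply.
    apply/seqspace_cvgP => i; apply/cvgrPdist_lt => e e0.
    exists i, e => // y yx; rewrite distrC; exact: yx.
  have near_i (i : 'I_n.+1) : \forall y \near x, `|(y - x) i| < e.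
    have : y i @[y --> x] --> x i by exact: coord_continuous.
    by move/cvgrPdistC_lt => /(_ e e0).
  have : \forall y \near x, forall i : 'I_n.+1, `|(y - x) i| < e.
    exact: (@filter_forall _ _ (fun (i : 'I_n.+1) y => `|(y - x) i| < e) (nbhs x) _ near_i).
  apply: filterS => y yx; apply: eU => i ni.
  by have := yx (Ordinal (ni : (i < n.+1)%N)).
- by move=> x x0; apply/funext => i; apply/eqP; rewrite -normr_eq0 x0.
- move=> u uC.
  have /choice[l ul] i : exists l : K, u n i @[n --> \oo] --> l.
    exact: (complK (fun n => u n i) (uC i)).
  by exists l; apply/seqspace_cvgP => i; exact: ul.
Qed.

End SequenceSpace.

Lemma complex_complete (R : realType) :
  @sequentially_complete (R[i] : numFieldType).
Proof.
move=> u uC.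
(* Real and imaginary parts of a Cauchy sequence are Cauchy, as both are
   bounded by the modulus. *)
have cR (p : {additive R[i] -> R}) :
  (forall z : R[i], `|p z|%:C%C <= `|z|) -> cvgn (p \o u).
  move=> ple; apply/cauchy_cvgP/cauchy_ballP => e e0; near_simpl.
  have e0' : 0 < (e%:C%C : R[i]) by rewrite ltcR.
  have [N uN] := uC _ e0'.
  exists ([set n | (N <= n)%N], [set n | (N <= n)%N]).
    by split; exists N.
  move=> [m n] /= [Nm Nn]; rewrite /ball /= -raddfB -ltcR.
  exact: le_lt_trans (ple _) (uN _ _ Nm Nn).
have /cvg_ex[a ua] := cR (@complex.Re R) (@normc_ge_Re R).
have /cvg_ex[b ub] : cvgn (@complex.Im R \o u).
  apply: (cR (@complex.Im R)) => z; change (`|complex.Im z|%:C%C <= `|z|).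
  rewrite -normrN -ReiNIm; apply: le_trans (normc_ge_Re _) _.
  by rewrite normrM [X in _ * X]normc_def /= expr0n expr1n add0r sqrtr1 mulr1.
exists (a%:C + 'i * b%:C)%C.
have -> : u = (fun n => (complex.Re (u n))%:C + 'i * (complex.Im (u n))%:C)%C.
  by apply/funext => n; exact: complexE.
apply: cvgD; first exact: real_complex_cvg.
by apply: (@cvgM (R[i] : numFieldType)); [exact: cvg_cst|exact: real_complex_cvg].
Qed.

(** * Maps into the space of sequences *)

Section IntoSequences.
Context {K : numFieldType} (S : set K).

Lemma smooth_data_coord (E : preTopologicalLmodType K) (U : set E)
    (D : seq E -> E -> seqspace K) : open U ->
  smooth_data S U D <-> forall n, smooth_data S U (fun hs x => D hs x n : K^o).
Proof.
move=> oU; split=> [[_ Dd Dc] n|sD].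
  split=> // [hs h x Ux|T G FG I s h l x x0 Ux0 xx0 hl].
    exact: (coord_cvg (n := n) (Dd hs h x Ux)).
  exact: (coord_cvg (n := n) (Dc T G FG I s h l x x0 Ux0 xx0 hl)).
split=> // [hs h x Ux|T G FG I s h l x x0 Ux0 xx0 hl].
  apply/seqspace_cvgP => n; have [_ Dd _] := sD n; exact: Dd.
by apply/seqspace_cvgP => n; have [_ _ Dc] := sD n; exact: Dc.
Qed.

Lemma smooth_on_sub (E F : preTopologicalLmodType K) (U V : set E) (f g : E -> F) :
  open V -> V `<=` U -> (forall x, V x -> f x = g x) ->
  smooth_on S U f -> smooth_on S V g.
Proof.
move=> oV VU fg /smooth_onP[D [oU Dd Dc] D0]; apply/smooth_onP; exists D.
  split=> // [hs h x Vx|T G FG I s h l x x0 Vx0 xx0 hl]; first exact/Dd/VU.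
  exact: (Dc T G FG I s h l x x0 (VU _ Vx0) xx0 hl).
by move=> x Vx; rewrite D0 ?fg //; exact: VU.
Qed.

Lemma rational_smooth_on (E : preTopologicalLmodType K) (J : Type)
    (lin : J -> E -> K^o) (j0 : J) (U : set E) (f : E -> seqspace K) :
  scalar_set S -> tvs_axiom E -> open U ->
  (forall j x a y, lin j (x + a *: y) = lin j x + a * lin j y) ->
  (forall j, continuous (lin j)) -> (forall x, U x -> lin j0 x != 0) ->
  (forall n, rational lin j0 U (fun x => f x n)) -> smooth_on S U f.
Proof.
move=> SS tvsE oU linP linC lin0 /choice[e ef]; apply/smooth_onP.
exists (fun hs x n => rational_data lin j0 (e n) hs x).
  by apply/smooth_data_coord => // n; exact: rational_smooth_data.
by move=> x Ux; apply/funext => n; exact: ef.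
Qed.

(** Smoothness and the derivatives are taken one coordinate of [g] at a time,
    which reduces the chain rule to scalar valued [g]. *)
Lemma smooth_on_comp (E F : preTopologicalLmodType K) (U : set E) (V : set F)
    (f : E -> F) (g : F -> seqspace K) :
  mean_value K -> scalar_set S -> tvs_axiom E -> tvs_axiom F ->
  smooth_on S U f -> smooth_on S V g -> (forall x, U x -> V (f x)) ->
  smooth_on S U (g \o f).
Proof.
move=> mvK SS tvsE tvsF /smooth_onP[Df sf Df0] /smooth_onP[Dg sg Dg0] fUV.
have [[oU _ _] [oV _ _]] := (sf, sg).
have Df0V x : U x -> V (Df [::] x) by move=> Ux; rewrite Df0 //; exact: fUV.
apply/smooth_onP; exists (fun hs x n => chain_data Df (fun ks y => Dg ks y n) hs x).
  apply/smooth_data_coord => // n; apply: (chain_smooth_data mvK SS tvsE tvsF sf _ Df0V).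
  by move/smooth_data_coord : sg; apply.
move=> x Ux; apply/funext => n.
by rewrite /chain_data /= big_seq1 /= Dg0 ?Df0 //; exact: fUV.
Qed.

Lemma smooth_on_cvg (E F : preTopologicalLmodType K) (U : set E) (f : E -> F)
    T (G : set_system T) {FG : Filter G} (x : T -> E) (x0 : E) :
  smooth_on S U f -> U x0 -> x t @[t --> G] --> x0 -> f (x t) @[t --> G] --> f x0.
Proof.
move=> /smooth_onP[D [oU _ Dc] D0] Ux0 xx0; rewrite -D0 //.
apply: cvg_trans _ (jointly_continuous_cst Dc Ux0 xx0); apply: near_eq_cvg.
have := xx0 _ (open_nbhs_nbhs (conj oU Ux0)).
suff : G [set t | U (x t)] -> \forall t \near G, D [::] (x t) = f (x t) by [].
by apply: filterS => t Ut; rewrite D0.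
Qed.

End IntoSequences.

(** * The maximal atlas of a global chart *)

Section GlobalChart.
Context {K : numFieldType} (S : set K).
Hypotheses (mvK : mean_value K) (SS : scalar_set S).
Context (M : ptopologicalType) (c0 : chart M (seqspace K)).
Hypotheses (c0_chart : is_chart c0) (c0T : cdom c0 = setT).
Hypothesis c0_compat : compatible S c0 c0.

Lemma cinvK (E : preTopologicalLmodType K) (c : chart M E) x : is_chart c ->
  cdom c x -> cinv c (c x) = x.
Proof. by move=> [_ _ ci _ _] cx; rewrite /cinv pinvKV ?inE. Qed.

(** The transition map factors through the global chart [c0]. Its domain is the
    preimage, under the continuous map [c0 \o cinv c], of the open set
    [c0 @` cdom d]; this is why it is open. *)
Lemma transition_smooth (c d : chart M (seqspace K)) :
  is_chart c -> is_chart d -> compatible S c c0 -> compatible S d c0 ->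
  smooth_on S (c @` (cdom c `&` cdom d)) (d \o cinv c).
Proof.
move=> cc cd [cc0 _] [_ c0d].
have [_ _ c0i _ _] := c0_chart; rewrite c0T in c0i.
have c0I p q : c0 p = c0 q -> p = q by move=> e; apply: c0i; rewrite ?inE.
rewrite c0T setIT in cc0; rewrite c0T setIT in c0d.
have [[oW _] [oV _]] := (cc0, c0d).
have oU : open (c @` (cdom c `&` cdom d)).
  rewrite openE => _ [p [cp dp] <-].
  have Wp : (c @` cdom c) (c p) by exists p.
  have fc : (c0 \o cinv c) y @[y --> c p] --> (c0 \o cinv c) (c p).
    have yy : y @[y --> c p] --> c p by [].
    exact (smooth_on_cvg (x := id) cc0 Wp yy).
  have V0 : (c0 @` cdom d) ((c0 \o cinv c) (c p)).
    by exists p => //=; rewrite cinvK.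
  have nV : nbhs (c p) [set y | (c0 @` cdom d) ((c0 \o cinv c) y)].
    exact: fc _ (open_nbhs_nbhs (conj oV V0)).
  have nW := open_nbhs_nbhs (conj oW Wp).
  suff : nbhs (c p) (c @` (cdom c `&` cdom d)) by [].
  move: nV nW; apply: filterS2 => y [q dq /= e] [p' cp' ep'].
  exists p' => //; split=> //; rewrite -ep' cinvK // in e.
  by rewrite -(c0I _ _ e).
apply: (smooth_on_sub (U := c @` (cdom c `&` cdom d))
    (f := (d \o cinv c0) \o (c0 \o cinv c))) => //.
  move=> _ [p [cp dp] <-] /=; congr (d _).
  by rewrite (cinvK cc) // cinvK // c0T.
apply: (smooth_on_comp mvK SS (@seqspace_tvs K) (@seqspace_tvs K) _ c0d).
  by apply: smooth_on_sub cc0 => // _ [p [cp dp] <-]; exists p.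
by move=> _ [p [cp dp] <-]; exists p => //=; rewrite cinvK.
Qed.

Lemma global_chart_in_atlas : maximal_atlas S [set c0] c0.
Proof. by split=> // d ->. Qed.

Lemma global_chart_maximal_atlas :
  is_maximal_atlas S (maximal_atlas S [set c0]).
Proof.
split=> [|B [Bc _ Bcomp] AB].
  split=> [c []//|x|c d [cc /(_ c0 erefl) cc0] [cd /(_ c0 erefl) dc0]].
    by exists c0; [exact: global_chart_in_atlas|rewrite c0T].
  by split; [|rewrite setIC]; exact: transition_smooth.
apply/seteqP; split=> // c Bcc; split; first exact: Bc.
by move=> _ ->; apply: Bcomp => //; exact/AB/global_chart_in_atlas.
Qed.

(** Between manifolds with global charts smoothness is tested in these charts;
    continuity comes with it, as [c] and the inverse of [c0] are continuous. *)
Lemma global_chart_smooth_map (N : ptopologicalType) (F : preTopologicalLmodType K)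
    (A : set (chart N F)) (c : chart N F) (f : N -> M) :
  A c -> cdom c = setT -> injective c -> continuous c ->
  smooth_on S (range c) (c0 \o f \o cinv c) ->
  smooth_map S A (maximal_atlas S [set c0]) f.
Proof.
move=> Ac cT cI cC sf.
have cK x : cinv c (c x) = x by rewrite /cinv pinvKV ?cT ?inE // => p q _ _; exact: cI.
split=> [z|x]; last first.
  exists c, c0; split=> //; rewrite ?c0T ?cT //; first exact: global_chart_in_atlas.
  by rewrite preimage_setT setIT.
have fE z' : f z' = cinv c0 ((c0 \o f \o cinv c) (c z')).
  by rewrite /= cK cinvK // c0T.
have zz : (c0 \o f \o cinv c) (c z') @[z' --> z] --> (c0 \o f \o cinv c) (c z).
  by apply: (smooth_on_cvg sf); [exists z|exact: cC].
have [_ oI _ _ c0C] := c0_chart.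
rewrite continuous_open_subspace // in c0C.
have c0z : (c0 @` cdom c0) ((c0 \o f \o cinv c) (c z)).
  by exists (f z); rewrite ?c0T //= cK.
have lim : cinv c0 ((c0 \o f \o cinv c) (c z')) @[z' --> z] -->
    cinv c0 ((c0 \o f \o cinv c) (c z)) by exact: cvg_comp zz (c0C _ (mem_set c0z)).
rewrite /continuous_at [f z]fE; apply: cvg_trans _ lim; apply: near_eq_cvg.
by apply: nearW => z'; rewrite [RHS]fE.
Qed.

End GlobalChart.

(** * The Lie group of formal power series *)

Section RationalSeries.
Context {K : numFieldType} (E : preTopologicalLmodType K) (J : Type).
Context (lin : J -> E -> K^o) (j0 : J) (U : set E).
Local Notation rat := (rational lin j0 U).
Implicit Types a b : nat -> E -> K.

Lemma rational_ps_exp a k n :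
  (forall i, rat (a i)) -> rat (fun x => ps_exp (a^~ x) k n).
Proof.
move=> ra; elim: k n => [|k IH] n; first exact: rational_cst.
apply: rational_sum => i _; exact: rationalM.
Qed.

Lemma rational_ps_comp a b n : (forall i, rat (a i)) -> (forall i, rat (b i)) ->
  rat (fun x => ps_comp (a^~ x) (b^~ x) n).
Proof.
move=> ra rb; apply: rational_sum => i _; apply: rationalM => //.
exact: rational_ps_exp.
Qed.

(** By induction along the recursion for the coefficients; the powers of [a_1] in
    the denominator are powers of one rational function. *)
Lemma rational_ps_linv a n : (forall i, rat (a i)) ->
  rat (fun x => (a 1%N x)^-1) -> rat (fun x => ps_linv (a^~ x) n).
Proof.
move=> ra rV; elim/ltn_ind: n => n IH.
apply: (rational_ext (f := fun x => (ps_X n + -1 *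
  \sum_(1 <= k < n) (ps_linv (a^~ x) k * ps_exp (a^~ x) k n)) * (a 1%N x)^-1 ^+ n)).
  by move=> x _; rewrite [RHS]ps_linvE mulN1r.
apply: rationalM; last exact: rationalX.
apply: rationalD; first exact: rational_cst.
apply: rationalM; first exact: rational_cst.
apply: (rational_ext (f := fun x => \sum_(1 <= k < n | (1 <= k < n)%N && true)
    ps_linv (a^~ x) k * ps_exp (a^~ x) k n)).
  by move=> x _; rewrite [RHS]big_nat_cond.
apply: rational_sum => k /andP[/andP[_ kn] _]; apply: rationalM; first exact: IH.
exact: rational_ps_exp.
Qed.

End RationalSeries.

Section Fps0Chart.
Context {K : numFieldType}.
Local Notation phi := (@fps0_chart K).
Implicit Types (a : fps0 K) (x y : seqspace K).

(** The inverse of the chart, as a sequence of coefficients: [x 0] is the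
    coefficient of [z]. *)
Definition tail_series x (n : nat) : K := if n is m.+1 then x m else 0.

Lemma coef_tail a : coef a = tail_series (phi a).
Proof. by apply/funext => -[|n] //=; exact: coef0. Qed.

Lemma fps0_chart_inj : injective phi.
Proof. by move=> a b e; apply: fps0_inj; rewrite !coef_tail e. Qed.

(** The coefficient of [z ^ 0], which the chart forgets, is constant. *)
Lemma fps0_cvgP T (G : set_system T) {FG : Filter G} (u : T -> fps0 K) a :
  u t @[t --> G] --> a <-> phi (u t) @[t --> G] --> phi a.
Proof.
have E1 : u t @[t --> G] --> a <-> (forall n, coef (u t) n @[t --> G] --> (coef a n : K^o)).
  rewrite -ptws_cvgP; exact: initial_cvgP.
rewrite E1 seqspace_cvgP; split=> H n; first exact: H.
case: n => [|n]; last exact: H.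
rewrite coef0; under eq_fun do rewrite coef0; exact: cvg_cst.
Qed.

Lemma fps0_chart_continuous : continuous phi.
Proof.
move=> a; have aa : u @[u --> a] --> a by [].
exact/(@fps0_cvgP _ (nbhs a) _ id a).
Qed.

Lemma tail_series_X0 x : x 0%N != 0 -> X0 (tail_series x).
Proof. by move=> /eqP x0; split. Qed.

Lemma range_fps0_chart : range phi = [set x | x 0%N != 0].
Proof.
apply/seteqP; split=> [_ [a _ <-]|x x0].
  by have [_ /eqP] := set_valP a.
by exists (SigSub (mem_set (tail_series_X0 x0))).
Qed.

Lemma open_range_fps0_chart : open (range phi).
Proof.
rewrite range_fps0_chart.
have -> : [set x : seqspace K | x 0%N != 0] = (fun x => x 0%N) @^-1` [set~ (0 : K^o)].
  by apply/seteqP; split=> x /= /eqP.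
apply: open_comp; first by move=> x _; exact: coord_continuous.
exact/closed_openC/accessible_closed_set1/hausdorff_accessible/norm_hausdorff.
Qed.

Lemma fps0_chartK a : cinv phi (phi a) = a.
Proof. by rewrite /cinv pinvKV ?inE // => b c _ _; exact: fps0_chart_inj. Qed.

Lemma fps0_is_chart : is_chart phi.
Proof.
split=> /=; first exact: openT.
- exact: open_range_fps0_chart.
- by move=> a b _ _; exact: fps0_chart_inj.
- by apply: continuous_subspaceT; exact: fps0_chart_continuous.
rewrite continuous_open_subspace; last exact: open_range_fps0_chart.
move=> y; rewrite inE => -[a _ <-].
suff : phi (cinv phi t) @[t --> phi a] --> phi (cinv phi (phi a)).
  by move/(@fps0_cvgP _ (nbhs (phi a)) _ (cinv phi)).
rewrite fps0_chartK => B nB.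
have nR := open_nbhs_nbhs (conj open_range_fps0_chart (ex_intro2 _ _ a Logic.I erefl)).
suff : nbhs (phi a) [set z | B (phi (cinv phi z))] by [].
move: nB nR; apply: filterS2 => z Bz [b _ bz]; rewrite -bz in Bz *.
by suff : B (phi (cinv phi (phi b))) by []; rewrite fps0_chartK.
Qed.

Lemma fps0_hausdorff : hausdorff_space (fps0 K).
Proof.
move=> a b ab; apply: fps0_chart_inj; apply/funext => n.
apply: (@norm_hausdorff _ K^o) => A B nA nB.
have pC (c : fps0 K) : (phi d n : K^o) @[d --> c] --> (phi c n : K^o).
  exact: (coord_cvg (n := n) (@fps0_chart_continuous c)).
have [c [Ac Bc]] := ab _ _ (pC a _ nA) (pC b _ nB).
by exists (phi c n).
Qed.

End Fps0Chart.

Section Fps0Lie.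
Context {K : numFieldType} (S : set K).
Hypotheses (mvK : mean_value K) (SS : scalar_set S).
Local Notation phi := (@fps0_chart K).

Lemma fps0_chart_compatible : compatible S phi phi.
Proof.
suff sm : smooth_on S (phi @` (cdom phi `&` cdom phi)) (phi \o cinv phi) by split.
rewrite setIT; apply: (smooth_on_sub (U := range phi) (f := id)) => //.
- exact: open_range_fps0_chart.
- by move=> _ [a _ <-] /=; rewrite fps0_chartK.
apply: (rational_smooth_on (lin := fun n (x : seqspace K) => x n) (j0 := 0%N)) => //.
- exact: seqspace_tvs.
- exact: open_range_fps0_chart.
- by move=> n; exact: coord_continuous.
- by move=> x; rewrite range_fps0_chart.
- by move=> n; exact: rational_lin.
Qed.

Lemma fps0_inv_smooth :
  smooth_map S (maximal_atlas S [set phi]) (maximal_atlas S [set phi]) (@fps0_inv K).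
Proof.
apply: (global_chart_smooth_map (@fps0_is_chart K) _ fps0_chart_compatible
  (c := phi)) => //.
- exact/global_chart_in_atlas/fps0_chart_compatible/fps0_is_chart.
- exact: fps0_chart_inj.
- exact: fps0_chart_continuous.
pose f (x : seqspace K) : seqspace K := fun n => ps_linv (tail_series x) n.+1.
apply: (smooth_on_sub (U := range phi) (f := f)) => //.
- exact: open_range_fps0_chart.
- by move=> _ [a _ <-] /=; rewrite fps0_chartK /f -coef_tail.
apply: (rational_smooth_on (lin := fun n (x : seqspace K) => x n) (j0 := 0%N)) => //.
- exact: seqspace_tvs.
- exact: open_range_fps0_chart.
- by move=> n; exact: coord_continuous.
- by move=> x; rewrite range_fps0_chart.
move=> n; apply: (rational_ps_linv n.+1 (a := fun i x => tail_series x i)) => [i|].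
  by case: i => [|i]; [exact: rational_cst|exact: (rational_lin _ _ _ i)].
exact: rational_inv.
Qed.

Lemma fps0_mul_smooth :
  smooth_map S (prod_atlas (maximal_atlas S [set phi]) (maximal_atlas S [set phi]))
    (maximal_atlas S [set phi]) (fun z => fps0_comp z.1 z.2).
Proof.
have rangeE : range (prod_chart phi phi) = range phi `*` range phi.
  apply/seteqP; split=> [_ [[a b] _ <-]|[_ _] [/= [a _ <-] [b _ <-]]].
    by split; [exists a|exists b].
  by exists (a, b).
have inj : injective (prod_chart phi phi).
  by move=> [a b] [c d] [/fps0_chart_inj -> /fps0_chart_inj ->].
have cK z : cinv (prod_chart phi phi) (prod_chart phi phi z) = z.
  by rewrite /cinv pinvKV ?inE // => p q _ _; exact: inj.
have oU : open (range phi `*` range phi) by apply: open_setX; exact: open_range_fps0_chart.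
apply: (global_chart_smooth_map (@fps0_is_chart K) _ fps0_chart_compatible
  (c := prod_chart phi phi)) => //.
- exists phi, phi; last by [].
  by split; exact/global_chart_in_atlas/fps0_chart_compatible/fps0_is_chart.
- by rewrite /= setXTT.
- move=> z.
  have c1 : phi w.1 @[w --> z] --> phi z.1.
    have w1 : w.1 @[w --> z] --> z.1 by exact: cvg_fst.
    exact: cvg_comp w1 (@fps0_chart_continuous K z.1).
  have c2 : phi w.2 @[w --> z] --> phi z.2.
    have w2 : w.2 @[w --> z] --> z.2 by exact: cvg_snd.
    exact: cvg_comp w2 (@fps0_chart_continuous K z.2).
  exact: cvg_pair c1 c2.
pose f (z : seqspace K * seqspace K) : seqspace K :=
  fun n => ps_comp (tail_series z.1) (tail_series z.2) n.+1.
rewrite rangeE; apply: (smooth_on_sub (U := range phi `*` range phi) (f := f)) => //.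
  by rewrite -rangeE => _ [z _ <-]; rewrite /= cK /f /= -!coef_tail.
(* Coordinates of a pair: the boolean selects the factor. *)
pose lin (j : bool * nat) (z : seqspace K * seqspace K) : K^o :=
  if j.1 then z.1 j.2 else z.2 j.2.
apply: (rational_smooth_on (lin := lin) (j0 := (true, 0%N))) => //.
- by apply: prod_tvs; exact: seqspace_tvs.
- by move=> [[] n].
- move=> [[] n] z; rewrite /lin /=.
    exact: (coord_cvg (n := n) (cvg_fst : fst w @[w --> z] --> z.1)).
  exact: (coord_cvg (n := n) (cvg_snd : snd w @[w --> z] --> z.2)).
- by move=> [x y]; rewrite range_fps0_chart => -[].
move=> n; apply: (rational_ps_comp n.+1 (a := fun i z => tail_series z.1 i)
  (b := fun i z => tail_series z.2 i)) => -[|i]; try exact: rational_cst.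
  exact: (rational_lin lin _ _ (true, i)).
exact: (rational_lin lin _ _ (false, i)).
Qed.

Lemma fps0_lie_group : sequentially_complete (K := K) ->
  frechet_lie_group S (@fps0_comp K) (maximal_atlas S [set phi]).
Proof.
move=> complK; split; first exact: seqspace_frechet.
  split; first exact: fps0_hausdorff.
  by apply: global_chart_maximal_atlas => //;
     [exact: fps0_is_chart|exact: fps0_chart_compatible].
exists fps0_one, (@fps0_inv K); split; first exact: fps0_is_group.
  exact: fps0_mul_smooth.
exact: fps0_inv_smooth.
Qed.

End Fps0Lie.

Lemma real_scalars_scalar_set (R : realType) :
  @scalar_set (R[i] : numFieldType) (range (real_complex R)).
Proof.
split=> [t /complex_realP[r ->]|_ _ [r _ <-] [s _ <-]|_ [r _ <-]].
- by exists r.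
- by exists (r * s); rewrite // rmorphM.
- by exists r^-1; rewrite // fmorphV.
Qed.

Theorem proposition4p2 (R : realType) :
  let real_scalars : set R[i] := range (real_complex R) in
  let complex_scalars : set R[i] := setT in
  frechet_lie_group real_scalars fps0_comp
    (maximal_atlas real_scalars [set fps0_chart (K := R[i])]) /\
  frechet_lie_group complex_scalars fps0_comp
    (maximal_atlas complex_scalars [set fps0_chart (K := R[i])]).
Proof.
move=> real_scalars complex_scalars; split; apply: fps0_lie_group.
- exact: complex_mean_value.
- exact: real_scalars_scalar_set.
- exact: complex_complete.
- exact: complex_mean_value.
- by split.
- exact: complex_complete.
Qed.
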